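(* Let $k\ge 2$ and $t\ge 2$ be integers, let $c>0$ be a real number, and let $\lambda_2$ be the second largest eigenvalue of the matrix $T(k,t,c)$. Then $$v(k,\lambda_2)\le M(k,t,c)=1+\sum_{i=0}^{t-3}k(k-1)^i+\frac{k(k-1)^{t-2}}{c}.$$ Moreover, let $G$ be a connected $k$-regular graph with second largest eigenvalue at most $\lambda_2$ and with exactly $v(k,\lambda_2)$ vertices. Then $v(k,\lambda_2)=M(k,t,c)$ if and only if $G$ is distance-regular with quotient matrix $T(k,t,c)$ with respect to the distance partition.
   Context: Graphs are finite and simple. For a connected $k$-regular graph $G$ on $n$ vertices, the eigenvalues of its adjacency matrix are written $k=\lambda_1(G)>\lambda_2(G)\ge\dots\ge\lambda_n(G)$, and $\lambda_2(G)$ is called the second largest eigenvalue. For real $\lambda$, $v(k,\lambda)$ denotes the maximum number of vertices of a connected $k$-regular graph $G$ with $\lambda_2(G)\le\lambda$ (taken to be $0$ if no such graph exists). $T(k,t,c)$ is the $t\times t$ tridiagonal matrix with lower diagonal $(1,1,\dots,1,c)$, upper diagonal $(k,k-1,\dots,k-1)$, and diagonal entries chosen so that every row sum equals $k$. (For $t=2$ the lower diagonal is $(c)$ and the upper diagonal is $(k)$.) Its eigenvalues are real and simple, the largest being $k$. Empty sums are $0$. A distance-regular graph has quotient matrix $T(k,t,c)$ with respect to the distance partition (from any vertex) precisely when it has diameter $t-1$ and intersection array $\{k,k-1,\dots,k-1;1,\dots,1,c\}$. *)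

(* Defs.v *)
From HB Require Import structures.
From mathcomp Require Import all_boot all_order all_algebra.
From mathcomp Require Import polyrcf.
From mathcomp Require Import all_classical all_reals ereal.

Set Implicit Arguments.
Unset Strict Implicit.
Unset Printing Implicit Defensive.

Import Order.TTheory GRing.Theory Num.Theory.
Local Open Scope ring_scope.

Record sgraph := SGraph {
  vertex :> finType;
  adj : rel vertex;
  adj_sym : symmetric adj;
  adj_irr : irreflexive adj
}.

(* The empty graph is not connected. *)
Definition is_connected (G : sgraph) : Prop :=
  (0 < #|G|)%N /\ forall x y : G, connect (@adj G) x y.

Definition kregular (G : sgraph) (k : nat) : Prop :=
  forall x : G, #|[set y | adj x y]| = k.

Definition adjmx (R : realType) (G : sgraph) : 'M[R]_#|G| :=
  \matrix_(i, j) (adj (enum_val i) (enum_val j))%:R.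

(* All real eigenvalues, in decreasing order and repeated according to their
   algebraic multiplicity as roots of the characteristic polynomial. *)
Definition spectrum (R : realType) (n : nat) (A : 'M[R]_n) : seq R :=
  sort (fun x y => y <= x)
    (flatten [seq nseq (mup x (char_poly A)) x | x <- rootsR (char_poly A)]).

(* Indexing starts at 0, so this is the second term of the sequence. *)
Definition second_eigenvalue (R : realType) (n : nat) (A : 'M[R]_n) : R :=
  (spectrum A)`_1.

Definition admissible (R : realType) (k : nat) (lam : R) (G : sgraph) : Prop :=
  [/\ is_connected G, kregular G k & second_eigenvalue (adjmx R G) <= lam].

(* The value is 0 if there is no admissible graph, and would be +oo if the
   orders of admissible graphs were unbounded; otherwise the supremum is a
   maximum (lemma vmaxP). *)
Definition vmax (R : realType) (k : nat) (lam : R) : \bar R :=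
  ereal_sup [set x | x = 0%:E \/
    exists2 G : sgraph, admissible k lam G & x = (#|G|%:R)%:E]%classic.

Lemma vmaxP (R : realType) (k : nat) (lam : R) (n : nat) :
  vmax k lam = (n%:R)%:E <->
  (exists2 G : sgraph, admissible k lam G /\ #|G| = n &
     forall H : sgraph, admissible k lam H -> (#|H| <= n)%N) \/
  ((forall G : sgraph, ~ admissible k lam G) /\ n = 0%N).
Proof.
have ub H : admissible k lam H -> ((#|H|%:R)%:E <= vmax k lam)%E.
  by move=> adH; apply: ereal_sup_ubound; right; exists H.
split=> [vn | [[G [adG Gn] maxG] | [noG ->]]].
- have maxn H : admissible k lam H -> (#|H| <= n)%N.
    by move=> /ub; rewrite vn lee_fin ler_nat.
  case: (posnP n) => [n0 | n_gt0].
    right; split=> // G adG; have := maxn _ adG.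
    by case: adG => -[G_gt0 _] _ _; rewrite n0 leqNgt G_gt0.
  have : ((n.-1%:R : R)%:E < vmax k lam)%E.
    by rewrite vn lte_fin ltr_nat prednK.
  case/ereal_sup_gt => x [-> | [G adG ->]]; rewrite lte_fin.
    by rewrite ltNge ler0n.
  rewrite ltr_nat prednK // => leG.
  by left; exists G => //; split=> //; apply/eqP; rewrite eqn_leq leG maxn.
- apply/eqP; rewrite eq_le -{2}Gn ub // andbT.
  apply: ge_ereal_sup => x [-> | [H adH ->]]; rewrite lee_fin ?ler0n //.
  by rewrite ler_nat maxG.
- apply/eqP; rewrite eq_le; apply/andP; split.
    by apply: ge_ereal_sup => x [-> // | [H /noG]].
  by apply: ereal_sup_ubound; left.
Qed.

(* The length of a shortest walk from x to y; #|G| if there is none. *)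
Definition dist (G : sgraph) (x y : G) : nat :=
  find (fun m => [exists p : m.-tuple G, path (@adj G) x p && (last x p == y)])
    (iota 0 #|G|).

(* b and c give the intersection array; for y = x the second count is of an
   empty set, so c 0 = 0. *)
Definition distance_regular (G : sgraph) : Prop :=
  is_connected G /\ exists b c : nat -> nat, forall x y : G,
    #|[set z | adj y z & dist x z == (dist x y).+1]| = b (dist x y) /\
    #|[set z | adj y z & (dist x z).+1 == dist x y]| = c (dist x y).

(* From every vertex x the distance partition has exactly t cells, namely the
   spheres of radius 0, ..., t-1 around x, and it is equitable with quotient
   matrix Q. *)
Definition distance_quotient (R : realType) (G : sgraph) (t : nat)
    (Q : 'M[R]_t) : Prop :=
  forall x : G,
    [/\ forall y : G, (dist x y < t)%N,
        forall i : 'I_t, exists y : G, dist x y = i &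
        forall (i j : 'I_t) (y : G), dist x y = i ->
          (#|[set z | adj y z & dist x z == j]|)%:R = Q i j].

Definition Toff (R : realType) (k t : nat) (c : R) (i j : nat) : R :=
  if i == j.+1 then (if i == t.-1 then c else 1)
  else if j == i.+1 then (if i == 0%N then k%:R else k%:R - 1)
  else 0.

Definition Tmx (R : realType) (k t : nat) (c : R) : 'M[R]_t :=
  \matrix_(i, j) if i == j then k%:R - \sum_(l < t | l != i) Toff k t c i l
                 else Toff k t c i j.

Definition Mbound (R : realType) (k t : nat) (c : R) : R :=
  1 + \sum_(0 <= i < t - 2) k%:R * (k%:R - 1) ^+ i
    + k%:R * (k%:R - 1) ^+ (t - 2) / c.

(* Main.v *)
Require Import Defs.
From mathcomp Require Import all_boot all_order all_algebra.
From mathcomp Require Import polyrcf complex.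
From mathcomp Require Import all_classical all_reals ereal.
From mathcomp Require Import ring lra.

(** Write A for the adjacency matrix of a connected k-regular graph G, F_i for
    the polynomial such that F_i(A) counts non-backtracking walks of length i,
    G_i = F_0 + ... + F_i, and m = t - 2.  The bound is a linear programming
    (Delsarte type) argument carried by one polynomial, P = F_(m+1) + c G_m.

    The characteristic polynomial of T(k,t,c) is (x - k) P ([char_poly_Tmx]),
    so lambda_2 is the largest root lam of P.  The G_i satisfy a three-term
    recurrence, hence behave like orthogonal polynomials: the largest roots
    interlace, so G_i(lam) > 0 for i <= m ([nbball_gt0_root]), and the
    Christoffel-Darboux kernel S = sum_i (k-1)^(m-i) G_i(lam) G_i satisfies
    (x - lam) S = G_m(lam) P ([nbkernel_Tpoly]).

    Evaluate the trace of G_m(lam) P(A) S(A) = (A - lam) S(A)^2 in two ways.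
    On the spectral side every eigenvalue other than k is at most lam and
    contributes a nonpositive amount, so the trace is at most
    G_m(lam) P(k) S(k).  On the combinatorial side S(A) has nonnegative entries,
    supported on the pairs for which G_m(A) counts at least one walk; there the
    entry of P(A) is at least c.  So the trace of P(A) S(A) is at least c times
    the sum of the entries of S(A), which is c |G| S(k).  Therefore
    c |G| <= P(k) = c M(k,t,c) ([order_trace_bound]).

    If equality holds, P vanishes at all eigenvalues other than k, so P(A) is c
    times the all-ones matrix.  Since walk counts are integers, any two vertices
    are then joined either by exactly one non-backtracking walk of length at
    most m and none of length m+1, or by none of length at most m and c of
    length m+1.  So F_i(A) is the distance-i matrix for i <= m and F_(m+1)(A) is
    c times the distance-(m+1) matrix, and the recurrence of the F_i becomes the
    quotient matrix T(k,t,c) ([equality_quotient]).  Conversely, counting edges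
    between consecutive spheres of a graph with quotient T(k,t,c) gives the
    sphere sizes F_i(k) and F_(m+1)(k)/c, whose sum is M ([quotient_order]). *)

Set Implicit Arguments.
Unset Strict Implicit.
Unset Printing Implicit Defensive.

Import Order.TTheory GRing.Theory Num.Theory.
Local Open Scope ring_scope.

(** * Non-backtracking polynomials *)

(** Number of ways to prolong a non-backtracking walk of length [l] by one
    edge in a k-regular graph. *)
Definition branching (R : realType) (k l : nat) : R :=
  if l == 0%N then k%:R else k%:R - 1.

Fixpoint nbpoly (R : realType) (k i : nat) : {poly R} :=
  if i is j.+1 then
    if j is l.+1 then
      'X * nbpoly R k j - (branching R k l)%:P * nbpoly R k l
    else 'X
  else 1.

Definition nbball (R : realType) (k m : nat) : {poly R} :=
  \sum_(i < m.+1) nbpoly R k i.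

Section Polynomials.

Variables (R : realType) (k : nat).
Hypothesis hk : (2 <= k)%N.

Local Notation F := (nbpoly R k).
Local Notation G := (nbball R k).

Lemma nbpolyS i :
  F i.+2 = 'X * F i.+1 - (branching R k i)%:P * F i.
Proof. by []. Qed.

Lemma nbball0 : G 0 = 1.
Proof. by rewrite /nbball big_ord1. Qed.

Lemma nbballS m : G m.+1 = G m + F m.+1.
Proof. by rewrite /nbball big_ord_recr. Qed.

(** The two exceptional initial steps of the recurrence of the [F i] cancel on
    summation: the partial sums obey one recurrence with constant coefficients. *)
Lemma nbball_rec m : 'X * G m.+1 = G m.+2 + (k%:R - 1)%:P * G m.
Proof.
elim: m => [|m IH].
  rewrite !nbballS nbball0 nbpolyS /branching /= rmorphB /= rmorph1.
  by set K := _%:P; ring.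
rewrite nbballS mulrDr IH (nbballS m.+2) (nbballS m) nbpolyS /branching /=.
by set K := _%:P; ring.
Qed.

Lemma nbball_rec_horner m y :
  y * (G m.+1).[y] = (G m.+2).[y] + (k%:R - 1) * (G m).[y].
Proof. by move/(congr1 (horner^~ y)): (nbball_rec m); rewrite !hornerE. Qed.

Let k1_ge1 : 1 <= k%:R - 1 :> R.
Proof. by rewrite lerBrDr -[1 + 1]/(2%:R) ler_nat. Qed.

Lemma nbpoly_monic i : F i \is monic /\ size (F i) = i.+1.
Proof.
suff: (F i \is monic /\ size (F i) = i.+1) /\
      (F i.+1 \is monic /\ size (F i.+1) = i.+2) by case.
elim: i => [|i [[m0 s0] [m1 s1]]].
  by rewrite /= monic1 monicX size_poly1 size_polyX.
have sX : size ('X * F i.+1) = i.+3.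
  by rewrite mulrC size_mulX ?monic_neq0 // s1.
have lt : (size (- ((branching R k i)%:P * F i))%R <
           size ('X * F i.+1)%R)%N.
  by rewrite size_polyN sX mul_polyC (leq_ltn_trans (size_scale_leq _ _)) ?s0.
do !split=> //; rewrite nbpolyS ?monicE.
  by rewrite lead_coefDl // mulrC lead_coefMX (monicP m1).
by rewrite size_polyDl.
Qed.

Lemma nbball_small m : (size (G m) <= m.+1)%N.
Proof.
apply: (leq_trans (size_sum _ _ _)); apply/bigmax_leqP => i _.
by have [_ ->] := nbpoly_monic i.
Qed.

Lemma nbpoly_valency i : (F i.+1).[k%:R] = k%:R * (k%:R - 1) ^+ i.
Proof.
suff: (F i.+1).[k%:R] = k%:R * (k%:R - 1) ^+ i /\
      (F i.+2).[k%:R] = k%:R * (k%:R - 1) ^+ i.+1 by case.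
elim: i => [|i [IH0 IH1]]; first by rewrite !hornerE /branching /=; split; ring.
split=> //; rewrite nbpolyS hornerD hornerN !hornerM hornerX hornerC IH0 IH1.
by rewrite /branching /= !exprS; ring.
Qed.

(** The induction needs the growth F_(i+1) >= (k-1) F_i on [k, +oo[ to
    absorb the subtracted term of the recurrence. *)
Lemma nbpoly_gt0 i y : k%:R <= y -> 0 < (F i).[y].
Proof.
move=> ky; suff: 0 < (F i).[y] /\ (k%:R - 1) * (F i).[y] <= (F i.+1).[y] by case.
elim: i => [|i [IH0 IH1]]; first by rewrite /= !hornerE; split=> //; lra.
have pos : 0 < (F i.+1).[y].
  by apply: lt_le_trans IH1; rewrite mulr_gt0 // (lt_le_trans ltr01).
split=> //; rewrite nbpolyS hornerD hornerN !hornerM hornerX hornerC.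
have k1 := k1_ge1; rewrite /branching; case: i IH0 IH1 pos => [|i] /=.
  rewrite !hornerE => _ _ y0; have : 0 <= (y - k%:R) * (y + 1).
    by rewrite mulr_ge0 ?subr_ge0 // addr_ge0 // ltW.
  nra.
move=> F0 FS pos; have : 0 <= (y - k%:R) * (F i.+2).[y].
  by rewrite mulr_ge0 ?subr_ge0 // ltW.
lra.
Qed.

Lemma nbball_gt0 m y : k%:R <= y -> 0 < (G m).[y].
Proof.
move=> ky; elim: m => [|m IH]; first by rewrite nbball0 hornerE.
by rewrite nbballS hornerD addr_gt0 // nbpoly_gt0.
Qed.

Lemma seq_max (s : seq R) x : x \in s ->
  exists2 z, z \in s & forall y, y \in s -> y <= z.
Proof.
elim: s x => // a [|b s] IH x _.
  by exists a; rewrite ?mem_head // => y; rewrite inE => /eqP->.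
have [z zs zmax] := IH b (mem_head _ _).
have [az|za] := leP a z.
  exists z; first by rewrite in_cons zs orbT.
  move=> y; rewrite in_cons.
  by case/predU1P => [->|/zmax].
exists a; first exact: mem_head.
move=> y; rewrite in_cons => /predU1P[->//|/zmax yz].
exact: le_trans yz (ltW za).
Qed.

(** Since [q] is eventually positive, the intermediate value theorem gives a root
    to the right of any nonpositive value, so none occurs beyond the largest
    root. *)
Lemma largest_root (q : {poly R}) a y0 :
  (forall y, a <= y -> 0 < q.[y]) -> q.[y0] <= 0 ->
  exists mu, [/\ y0 <= mu, root q mu & forall y, mu < y -> 0 < q.[y]].
Proof.
move=> qpos q0.
have ivt y : q.[y] <= 0 -> exists2 z, y <= z & root q z.
  move=> qy; have ya : y <= Num.max a y by rewrite le_max lexx orbT.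
  have qa : 0 <= q.[Num.max a y] by rewrite ltW // qpos // le_max lexx.
  have [|z zy rz] := @poly_ivt _ q _ _ ya; first by rewrite qy qa.
  by exists z => //; case/andP: zy.
have q_neq0 : q != 0.
  by apply/eqP => q00; have := qpos a (lexx a); rewrite q00 horner0 ltxx.
have inR z : root q z = (z \in rootsR q).
  by have := roots_on_rootsR q_neq0 z; rewrite in_itv.
have [z0 yz0 rz0] := ivt _ q0.
have [|mu muR mumax] := @seq_max (rootsR q) z0; first by rewrite -inR.
exists mu; split; rewrite ?inR //.
  by apply: le_trans yz0 _; apply: mumax; rewrite -inR.
move=> y muy; rewrite ltNge; apply/negP => /ivt[z yz]; rewrite inR => /mumax zmu.
by move: (lt_le_trans muy (le_trans yz zmu)); rewrite ltxx.
Qed.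

(** Interlacing of largest roots, in the form needed: beyond the largest root of
    any G_(m+1) + s G_m, all lower G_i are positive.  If G_m had a root there,
    then at its largest root mu one has G_(m-1)(mu) > 0 by induction, so the
    recurrence gives G_(m+1)(mu) = - (k-1) G_(m-1)(mu) < 0. *)
Lemma nbball_gt0_root m s lam :
  (forall y, lam <= y -> 0 <= (G m.+1).[y] + s * (G m).[y]) ->
  forall i y, (i <= m)%N -> lam <= y -> 0 < (G i).[y].
Proof.
elim: m s lam => [|m IH] s lam nneg i y.
  by rewrite leqn0 => /eqP-> _; rewrite nbball0 hornerE.
have top z : lam <= z -> 0 < (G m.+1).[z].
  move=> lz; rewrite ltNge; apply/negP => Gz.
  have [mu [zmu rmu pos]] := largest_root (@nbball_gt0 m.+1) Gz.
  have mu0 : (G m.+1).[mu] = 0 by apply/rootP.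
  have : 0 < (G m).[mu].
    apply: (IH 0 mu) => // u; rewrite mul0r addr0 le_eqVlt.
    by case/predU1P=> [<-|/pos/ltW//]; rewrite mu0.
  have := nneg mu (le_trans lz zmu); have := nbball_rec_horner m mu.
  by have k1 := k1_ge1; rewrite mu0 !mulr0; nra.
rewrite leq_eqVlt => /predU1P[->|im] ly; first exact: top.
apply: (IH 0 lam) => // u lu.
by rewrite mul0r addr0 ltW // top.
Qed.

(** * Christoffel-Darboux kernel *)

Definition nbkernel m y : {poly R} :=
  \sum_(i < m.+1) ((k%:R - 1) ^+ (m - i) * (G i).[y]) *: G i.

Lemma nbkernelS m y :
  nbkernel m.+1 y = (k%:R - 1) *: nbkernel m y + (G m.+1).[y] *: G m.+1.
Proof.
rewrite /nbkernel big_ord_recr /= subnn expr0 mul1r; congr (_ + _).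
rewrite [RHS]scaler_sumr.
by apply: eq_bigr => i _; rewrite scalerA mulrA -exprS subSn // -ltnS.
Qed.

Lemma christoffel_darboux m y :
  ('X - y%:P) * nbkernel m y = (G m).[y] *: G m.+1 - (G m.+1).[y] *: G m.
Proof.
elim: m => [|m IH].
  rewrite /nbkernel big_ord1 expr0 mul1r nbballS nbball0 !hornerE /=.
  by rewrite !scale1r mulr1 -mul_polyC rmorphD /= rmorph1; ring.
rewrite nbkernelS mulrDr -scalerAr IH -scalerAr mulrBl (nbball_rec m).
have -> : (G m.+2).[y] = y * (G m.+1).[y] - (k%:R - 1) * (G m).[y].
  by rewrite nbball_rec_horner; ring.
rewrite -!mul_polyC !(polyCB, polyCM).
by set K := (k%:R)%:P; ring.
Qed.

End Polynomials.

(** * Spectra *)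

Section Spectra.

Variable R : realType.

Lemma count_spectrum n (A : 'M[R]_n) x :
  count_mem x (spectrum A) = mup x (char_poly A).
Proof.
have A0 : char_poly A != 0 by rewrite monic_neq0 ?char_poly_monic.
rewrite /spectrum; set rs := rootsR _.
have /permP-> : perm_eq (sort (fun x y => y <= x)
   (flatten [seq nseq (mup z (char_poly A)) z | z <- rs]))
   (flatten [seq nseq (mup z (char_poly A)) z | z <- rs]).
  by rewrite perm_sort.
rewrite count_flatten sumnE !big_map.
under eq_bigr do rewrite count_nseq /=.
have rsE : (x \in rs) = root (char_poly A) x.
  by have := roots_on_rootsR A0 x; rewrite in_itv.
have [xrs|xNrs] := boolP (x \in rs).
  rewrite (bigD1_seq x) //= ?eqxx ?mul1n ?big1 ?addn0 //.
    by move=> z /negPf->; rewrite mul0n.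
  exact: uniq_roots.
rewrite big_seq big1 ?mupNroot -?rsE // => z zrs.
by case: eqP zrs xNrs => [->->|_ _ _]; rewrite ?mul0n.
Qed.

Lemma spectrum_sorted n (A : 'M[R]_n) : sorted (fun x y => y <= x) (spectrum A).
Proof. by apply: sort_sorted => x y; rewrite orbC le_total. Qed.

Lemma perm_spectrum n (A : 'M[R]_n) s :
  char_poly A = \prod_(z <- s) ('X - z%:P) -> perm_eq (spectrum A) s.
Proof.
move=> As; apply/allP => x _ /=.
by rewrite count_spectrum As mu_prod_XsubC.
Qed.

(** When a root [a] dominating all others is split off the characteristic
    polynomial, the second entry of the sorted spectrum is the largest root of
    the cofactor; multiplicities are respected, as [q] may still vanish at [a]. *)
Lemma second_eigenvalueE n (A : 'M[R]_n) (q : {poly R}) a mu :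
  char_poly A = ('X - a%:P) * q -> root q mu ->
  (forall x, root q x -> x <= mu) -> mu <= a -> second_eigenvalue A = mu.
Proof.
move=> Aq rmu mumax mua.
have A0 : char_poly A != 0 by rewrite monic_neq0 ?char_poly_monic.
have q0 : q != 0 by apply: contraNneq A0 => q0; rewrite Aq q0 mulr0.
pose ge := fun x y : R => y <= x.
pose s := sort ge (rem mu (rem a (spectrum A))).
have cnt x : count_mem x (spectrum A) = ((x == a) + mup x q)%N.
  rewrite count_spectrum Aq mupM ?polyXsubC_eq0 // (@mup_XsubCX _ 1) eq_sym.
  by case: eqP.
have aA : a \in spectrum A by rewrite -has_pred1 has_count cnt eqxx.
have cnt' x : count_mem x (rem a (spectrum A)) = mup x q.
  have /permP/(_ (pred1 x)) := perm_to_rem aA.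
  by rewrite cnt /= eq_sym => /addnI->.
have muA : mu \in rem a (spectrum A).
  by rewrite -has_pred1 has_count cnt' -XsubC_dvd // dvdp_XsubCl.
have sE : perm_eq (spectrum A) [:: a, mu & s].
  apply: (perm_trans (perm_to_rem aA)); rewrite perm_cons.
  apply: (perm_trans (perm_to_rem muA)); rewrite perm_cons.
  by rewrite perm_sym perm_sort.
have -> : second_eigenvalue A = [:: a, mu & s]`_1 => //.
rewrite /second_eigenvalue; congr (nth _ _ _).
apply: (sorted_eq _ _ (spectrum_sorted A) _ sE).
- by move=> x y z /= xy yz; apply: le_trans yz xy.
- by move=> x y /= /andP[yx xy]; apply/eqP; rewrite eq_le xy yx.
rewrite /= mua /= path_sortedE; last by move=> x y z /= xy yz; apply: le_trans yz xy.
rewrite sort_sorted ?andbT; last by move=> x y; rewrite /ge orbC le_total.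
apply/allP => x; rewrite mem_sort => /mem_rem xs /=; apply: mumax.
by rewrite -dvdp_XsubCl XsubC_dvd // -cnt' -has_count has_pred1.
Qed.

(** Over R[i] the matrix is unitarily similar to a diagonal matrix with real
    diagonal, so both identities reduce to the diagonal case and descend to R. *)
Lemma symmetric_trace n (A : 'M[R]_n.+1) : A^T = A ->
  exists2 s : seq R, char_poly A = \prod_(z <- s) ('X - z%:P) &
    forall q : {poly R}, \tr (horner_mx A q) = \sum_(z <- s) q.[z].
Proof.
move=> Asym; pose f := real_complex R; pose AC := map_mx f A.
have AC_herm : AC \is hermsymmx.
  apply: realsym_hermsym.
    by apply/is_hermitianmxP; rewrite expr0 scale1r map_mx_id // map_trmx Asym.
  by apply/mxOverP => i j; rewrite mxE; apply/complex_realP; exists (A i j).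
pose P := spectralmx AC; pose D := spectral_diag AC.
have Pu : P \in unitmx by apply: spectral_unit.
have ACE : AC = invmx P *m diag_mx D *m P.
  by have /hermitian_normalmx/orthomx_spectralP := AC_herm.
pose d i := complex.Re (D 0 i).
have Dd i : D 0 i = f (d i).
  have /mxOverP/(_ 0 i) := hermitian_spectral_diag_real AC_herm.
  by move=> /RRe_real.
exists [seq d i | i <- enum 'I_n.+1].
  have finj : injective (map_poly f) by apply: map_poly_inj.
  apply: finj; rewrite map_char_poly -/AC rmorph_prod /= big_map big_enum /=.
  have -> : char_poly AC = char_poly (diag_mx D).
    rewrite /char_poly; have -> : char_poly_mx AC =
      map_mx polyC (invmx P) *m char_poly_mx (diag_mx D) *m map_mx polyC P.
      rewrite /char_poly_mx mulmxBr mulmxBl -!map_mxM -ACE; congr (_ - _).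
      by rewrite scalar_mxC -mulmxA -map_mxM mulVmx // map_mx1 mulmx1.
    rewrite !det_mulmx mulrAC -det_mulmx -map_mxM mulVmx // map_mx1 det1.
    by rewrite mul1r.
  rewrite char_poly_trig ?diag_mx_is_trig //; apply: eq_bigr => i _.
  by rewrite mxE eqxx mulr1n Dd map_polyXsubC.
move=> q; apply: (@complexI R).
rewrite -[LHS](trace_map_mx f) map_horner_mx -/AC.
rewrite ACE horner_mx_uconjC // horner_mx_diag -mulmxA mxtrace_mulC mulmxK //.
rewrite mxtrace_diag rmorph_sum big_map big_enum /=; apply: eq_bigr => i _.
by rewrite mxE Dd horner_map.
Qed.

End Spectra.

(** * The tridiagonal matrix *)

(** Rows and columns of a tridiagonal matrix have at most three nonzero entries;
    this collapses the sums over them. *)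
Lemma big_ord_supp (V : nmodType) n (f : nat -> V) (s : seq nat) :
  uniq s -> (forall i, i \in s -> (i < n)%N) ->
  (forall i, (i < n)%N -> i \notin s -> f i = 0) ->
  \sum_(i < n) f i = \sum_(i <- s) f i.
Proof.
move=> us sn f0; rewrite -(big_mkord xpredT f) /index_iota subn0.
rewrite (bigID (mem s)) /= [X in _ + X]big_seq_cond [X in _ + X]big1; last first.
  by move=> i /andP[]; rewrite mem_iota add0n => /andP[_ /f0]; apply.
rewrite addr0 -big_filter; apply: perm_big; apply: uniq_perm => //.
  by rewrite filter_uniq // iota_uniq.
move=> i; rewrite mem_filter mem_iota add0n /= andbC.
by case: (boolP (i \in s)) => [/sn->|]; rewrite ?andbF.
Qed.

Section Tridiagonal.

Variables (R : realType) (k m : nat) (c : R).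
Hypothesis hk : (2 <= k)%N.
Hypothesis hc : 0 < c.

Local Notation F := (nbpoly R k).
Local Notation G := (nbball R k).
Local Notation T := (Tmx k m.+2 c).
Local Notation Toff := (Toff k m.+2 c).

Lemma Toff_lower i : Toff i.+1 i = if i == m then c else 1.
Proof. by rewrite /Defs.Toff eqxx /= eqSS. Qed.

Lemma Toff_upper i : Toff i i.+1 = branching R k i.
Proof. by rewrite /Defs.Toff eqxx ltn_eqF // ltnW. Qed.

Lemma Toff_far i j : i != j.+1 -> j != i.+1 -> Toff i j = 0.
Proof. by rewrite /Defs.Toff => /negPf-> /negPf->. Qed.

Lemma sum_Toff i : (i <= m)%N -> \sum_(l < m.+2) Toff i l = k%:R.
Proof.
case: i => [_|i im].
  rewrite (@big_ord_supp _ _ _ [:: 1%N]) //.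
  - by rewrite big_seq1 Toff_upper.
  - by move=> i; rewrite inE => /eqP->.
  - by move=> i _; rewrite inE => i1; apply: Toff_far.
rewrite (@big_ord_supp _ _ _ [:: i; i.+2]).
- rewrite big_cons big_seq1 Toff_lower Toff_upper ltn_eqF // /branching /=.
  by rewrite addrC subrK.
- by rewrite /= inE ltn_eqF // ltnW.
- by move=> l; rewrite !inE => /orP[] /eqP->; rewrite ltnS // ltnW // ltnW.
- move=> l _; rewrite !inE negb_or => /andP[li li2].
  by apply: Toff_far; rewrite // eqSS eq_sym.
Qed.

(** All diagonal entries but the last are zero, because the off-diagonal part of
    these rows already sums to k. *)
Lemma Tmx_off (i j : 'I_m.+2) : (j <= m)%N -> T i j = Toff i j.
Proof.
move=> jm; rewrite mxE; case: eqP => // ->.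
have Tjj : Toff j j = 0 by rewrite Toff_far // ltn_eqF.
by rewrite Tjj -(sum_Toff jm) (bigD1 j) //= Tjj add0r subrr.
Qed.

Lemma Tmx_rowsum (i : 'I_m.+2) : \sum_j T i j = k%:R.
Proof.
rewrite (bigD1 i) //= mxE eqxx.
rewrite [X in _ - _ + X](eq_bigr (fun l : 'I_m.+2 => Toff i l)) ?subrK // => l.
by rewrite eq_sym mxE => /negPf->.
Qed.

(** The characteristic polynomial of T(k,t,c) deprived of its root k. *)
Definition Tpoly : {poly R} := F m.+1 + c *: G m.

Lemma Tpoly_horner y : Tpoly.[y] = (G m.+1).[y] + (c - 1) * (G m).[y].
Proof. by rewrite nbballS !hornerE; ring. Qed.

Lemma Tpoly_gt0 y : k%:R <= y -> 0 < Tpoly.[y].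
Proof.
by move=> ky; rewrite !hornerE addr_gt0 ?nbpoly_gt0 // mulr_gt0 ?nbball_gt0.
Qed.

Lemma Tpoly_monic : Tpoly \is monic /\ size Tpoly = m.+2.
Proof.
have [Fm Fs] := nbpoly_monic R k m.+1.
have lt : (size (c *: G m) < size (F m.+1))%N.
  by rewrite Fs ltnS (leq_trans (size_scale_leq _ _)) // nbball_small.
by rewrite monicE /Tpoly lead_coefDl // size_polyDl // (monicP Fm).
Qed.

(** The row vector V = (F_0, ..., F_m, F_(m+1)/c) is a formal left eigenvector:
    V (x - T) vanishes except in its last entry, which equals (x - k) P / c
    because all rows of T sum to k.  Multiplying by the adjugate of x - T and
    reading the first entry (F_0 = 1) shows that (x - k) P divides the
    characteristic polynomial; both are monic of the same degree. *)
Lemma char_poly_Tmx : char_poly T = ('X - k%:R%:P) * Tpoly.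
Proof.
pose v i : {poly R} := if i == m.+1 then c^-1 *: F m.+1 else F i.
pose V := \row_(j < m.+2) v j; pose M := char_poly_mx T.
pose w : {poly R} := c^-1 *: (('X - k%:R%:P) * Tpoly).
have ME i j : M i j = 'X *+ (i == j) - (T i j)%:P by rewrite !mxE.
have vF i : (i <= m)%N -> v i = F i by move=> im; rewrite /v ltn_eqF.
have VM0 (j : 'I_m.+2) : (j <= m)%N -> (V *m M) 0 j = 0.
  move=> jm; rewrite mxE.
  under eq_bigr do rewrite [V _ _]mxE ME mulrBr.
  rewrite sumrB (bigD1 j) //= eqxx mulr1n big1 ?addr0; last first.
    by move=> i /negPf->; rewrite mulr0n mulr0.
  under eq_bigr do rewrite Tmx_off //.
  rewrite vF //; apply/eqP; rewrite subr_eq0; apply/eqP.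
  rewrite (@big_ord_supp _ _ (fun i => v i * (Toff i j)%:P)
     (if j == 0%N :> nat then [:: 1%N] else [:: j.+1; j.-1])).
  - have low : v j.+1 * (Toff j.+1 j)%:P = F j.+1.
      rewrite Toff_lower /v eqSS; case: eqP => [->|_]; last by rewrite mulr1.
      by rewrite mulrC mul_polyC scalerA divff ?scale1r ?gt_eqF.
    case: (nat_of_ord j) jm low => [|i] im low /=.
      by rewrite big_seq1 low /= mul1r.
    rewrite big_cons big_seq1 low Toff_upper vF; last exact: ltnW.
    by rewrite nbpolyS (mulrC (F i)) subrK mulrC.
  - by case: ifP => // _; rewrite /= inE gtn_eqF // ltnS leq_pred.
  - move=> i; case: ifP => _; rewrite !inE; first by move/eqP->.
    by case/orP => /eqP->; rewrite ltnS // (leq_trans (leq_pred _)) // ltnW.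
  - move=> i im iN; rewrite [Toff _ _]Toff_far ?mulr0 //.
      by apply: contraNneq iN => ->; case: ifP => [/eqP->|_]; rewrite !inE eqxx.
    apply: contraNneq iN => ->.
    by rewrite /= !inE eqxx orbT.
have Vsum : \sum_j (V *m M) 0 j = w.
  under eq_bigr do rewrite mxE.
  rewrite exchange_big /=.
  have -> : \sum_i \sum_j V 0 i * M i j = \sum_i V 0 i * ('X - k%:R%:P).
    apply: eq_bigr => i _; rewrite -mulr_sumr; congr (_ * _).
    under eq_bigr do rewrite ME.
    rewrite sumrB -(Tmx_rowsum i) rmorph_sum (bigD1 i) //= eqxx mulr1n big1 ?addr0 //.
    by move=> j; rewrite eq_sym => /negPf->.
  rewrite -mulr_suml big_ord_recr /= mxE /v /= eqxx.
  have -> : \sum_(i < m.+1) V 0 (widen_ord (leqnSn m.+1) i) = G m.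
    by apply: eq_bigr => i _; rewrite mxE vF //= -ltnS.
  rewrite /w /Tpoly mulrC scalerAr scalerDr scalerA mulVf ?gt_eqF //.
  by rewrite scale1r addrC.
have VMlast : (V *m M) 0 ord_max = w.
  rewrite -Vsum big_ord_recr /= big1 ?add0r // => i _.
  by rewrite VM0 //= -ltnS.
have [monT sT] := Tpoly_monic.
have monw : ('X - k%:R%:P) * Tpoly \is monic by rewrite monicMr // monicXsubC.
have eqM : char_poly T = ('X - k%:R%:P) * Tpoly * (c^-1 *: (\adj M) ord_max 0).
  have : (V *m M *m \adj M) 0 0 = char_poly T.
    by rewrite -mulmxA mul_mx_adj mul_mx_scalar !mxE /v /= mulr1.
  rewrite mxE big_ord_recr /= big1 ?add0r => [|i _]; last first.
    by rewrite VM0 ?mul0r //= -ltnS.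
  by rewrite VMlast => <-; rewrite /w -scalerAl -scalerAr.
have cpm := char_poly_monic T.
have monA : c^-1 *: (\adj M) ord_max 0 \is monic.
  by move: cpm; rewrite eqM monicMl.
have := size_char_poly T.
rewrite eqM size_monicM ?monic_neq0 // size_monicM ?monicXsubC ?monic_neq0 //.
rewrite size_XsubC sT /= addSn => -[] /eqP.
rewrite -[X in _ == X]addn1 eqn_add2l => sA.
have sA1 : (size (c^-1 *: (\adj M) ord_max 0)%R <= 1)%N by rewrite (eqP sA).
move: monA; rewrite monicE (size1_polyC sA1) lead_coefC => /eqP->.
by rewrite mulr1.
Qed.

End Tridiagonal.

Section SecondEigenvalue.

Variables (R : realType) (k m : nat) (c : R).
Hypothesis hk : (2 <= k)%N.
Hypothesis hc : 0 < c.

(** If P were positive everywhere, [nbball_gt0_root] would make G_1 = x + 1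
    positive at -1; for m = 0 the root is explicit. *)
Lemma Tpoly_nonpos : exists y, (Tpoly k m c).[y] <= 0.
Proof.
case: (pselect (exists y, (Tpoly k m c).[y] <= 0)) => // noy.
have pos y : 0 < (Tpoly k m c).[y].
  by rewrite ltNge; apply/negP => yle; apply: noy; exists y.
case: (posnP m) pos => [->|m_gt0] pos.
  by exists (- c); rewrite /Tpoly nbball0 !hornerE addNr.
have nneg y : -1 <= y ->
    0 <= (nbball R k m.+1).[y] + (c - 1) * (nbball R k m).[y].
  by move=> _; rewrite -Tpoly_horner ltW.
have := nbball_gt0_root hk nneg m_gt0 (lexx (-1)).
by rewrite nbballS nbball0 !hornerE subrr ltxx.
Qed.

Lemma second_eigenvalue_Tmx (lam := second_eigenvalue (Tmx k m.+2 c)) :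
  [/\ root (Tpoly k m c) lam, lam < k%:R &
      forall i, (i <= m)%N -> 0 < (nbball R k i).[lam]].
Proof.
have [y0 y0le] := Tpoly_nonpos.
have [mu [_ rmu mupos]] := largest_root (@Tpoly_gt0 R k m c hk hc) y0le.
have muk : mu < k%:R.
  rewrite ltNge; apply/negP => /(Tpoly_gt0 m hk hc).
  by rewrite (rootP rmu) ltxx.
have mumax x : root (Tpoly k m c) x -> x <= mu.
  by move=> /rootP rx; rewrite leNgt; apply/negP => /mupos; rewrite rx ltxx.
have -> : lam = mu.
  exact: second_eigenvalueE (char_poly_Tmx k m hc) rmu mumax (ltW muk).
split=> // i im; apply: (@nbball_gt0_root _ _ hk m (c - 1) mu) => // y.
move=> muy; rewrite -Tpoly_horner.
move: muy; rewrite le_eqVlt => /predU1P[<-|/mupos/ltW//].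
by rewrite (rootP rmu).
Qed.

End SecondEigenvalue.

(** * Distances *)

Section Distance.

Variable G : sgraph.
Hypothesis Gconn : is_connected G.

(** Walks of length exactly [n], which is what [dist] searches for. *)
Definition walk (x y : G) (n : nat) : Prop :=
  exists2 p : seq G, size p = n & path (@adj G) x p && (last x p == y).

Lemma dist_leq (x y : G) n : walk x y n -> (dist x y <= n)%N.
Proof.
move=> [p sp pP]; have [nG|Gn] := ltnP n #|G|; last first.
  by apply: leq_trans Gn; rewrite -[X in (_ <= X)%N](size_iota 0) find_size.
rewrite leqNgt; apply/negP => /(before_find 0%N).
rewrite nth_iota // add0n => /negbT/existsPn noP.
by move/eqP: sp => sp; have := noP (Tuple sp); rewrite pP.
Qed.

Lemma walk_dist (x y : G) : walk x y (dist x y).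
Proof.
have [_ /(_ x y)/connectP[p0 p0P yE]] := Gconn.
case/shortenP: p0P yE => p pP pu _ yE {p0}.
have hs : has (fun m => [exists p : m.-tuple G, path (@adj G) x p &&
    (last x p == y)]) (iota 0 #|G|).
  apply/hasP; exists (size p).
    by rewrite mem_iota /= add0n; have := max_card (mem (x :: p)); rewrite (card_uniqP pu).
  by apply/existsP; exists (in_tuple p); rewrite pP yE eqxx.
have := nth_find 0%N hs; rewrite has_find size_iota in hs.
rewrite nth_iota // add0n => /existsP[q qP].
by exists q; rewrite ?size_tuple.
Qed.

Lemma dist_eq0 (x y : G) : (dist x y == 0%N) = (y == x).
Proof.
apply/eqP/eqP => [d0|->].
  by have [p] := walk_dist x y; rewrite d0 => /size0nil-> /= /eqP.
by apply/eqP; rewrite -leqn0; apply: dist_leq; exists [::]; rewrite //= eqxx.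
Qed.

Lemma dist_adj (x y z : G) : adj y z -> (dist x z <= (dist x y).+1)%N.
Proof.
move=> yz; have [p sp /andP[pP /eqP lp]] := walk_dist x y.
apply: dist_leq; exists (rcons p z); first by rewrite size_rcons sp.
by rewrite rcons_path pP lp yz last_rcons eqxx.
Qed.

Lemma dist_pred (x y : G) n : dist x y = n.+1 ->
  exists2 z, adj z y & dist x z = n.
Proof.
move=> dy; have [p] := walk_dist x y; rewrite dy.
case/lastP: p => // p y'; rewrite size_rcons => -[sp].
rewrite rcons_path last_rcons => /andP[/andP[pP lp] /eqP y'y].
rewrite y'y in lp; exists (last x p) => //; apply/eqP; rewrite eqn_leq.
rewrite dist_leq /=; last by exists p; rewrite ?pP /=.
by rewrite -ltnS -dy dist_adj.
Qed.

Lemma dist_between (x y : G) i : (i <= dist x y)%N -> exists z, dist x z = i.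
Proof.
have [n dy] : exists n, dist x y = n by exists (dist x y).
rewrite dy; elim: n y dy => [|n IH] y dy; first by rewrite leqn0 => /eqP->; exists y.
rewrite leq_eqVlt => /predU1P[->|]; first by exists y.
by rewrite ltnS; have [z _ /IH] := dist_pred dy.
Qed.

End Distance.

(** * Non-backtracking walks *)

Section Walks.

Variables (G : sgraph) (k : nat).
Hypothesis Gk : kregular G k.

(** Non-backtracking walks of length [i.+1] from [x] whose last step is from
    [z] to [y]: keeping the last edge makes the condition local. *)
Fixpoint nbarc (x : G) (i : nat) (z y : G) : nat :=
  if i is j.+1 then (adj z y * \sum_(w | w != y) nbarc x j w z)%N
  else (adj z y && (z == x)).

Definition nbw (x : G) (i : nat) (y : G) : nat :=
  if i is j.+1 then (\sum_z nbarc x j z y)%N else (y == x).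

Lemma nbarc_adj x i z y : nbarc x i z y = (adj z y * nbarc x i z y)%N.
Proof. by case: i => [|i] /=; case: (adj z y); rewrite ?mul1n ?mul0n. Qed.

Lemma sum_adj (y : G) : (\sum_z adj z y)%N = k.
Proof.
rewrite -(Gk y) -sum1_card [RHS]big_mkcond /=; apply: eq_bigr => z _.
by rewrite inE adj_sym; case: (adj y z).
Qed.

Lemma nbw1 x y : nbw x 1 y = adj x y.
Proof.
rewrite /= (bigD1 x) //= eqxx andbT big1 ?addn0 // => z /negPf->.
by rewrite andbF.
Qed.

(** Extending a walk of length i+1 by an edge either gives a non-backtracking
    walk of length i+2 or undoes the last edge; in the latter case one is left
    with a walk of length i together with a neighbour that could prolong it. *)
Lemma nbw_rec x i y :
  (\sum_z adj z y * nbw x i.+1 z)%N =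
  (nbw x i.+2 y + (k - (i != 0)) * nbw x i y)%N.
Proof.
have -> : (\sum_z adj z y * nbw x i.+1 z)%N =
   (nbw x i.+2 y + \sum_z adj z y * nbarc x i y z)%N.
  rewrite -big_split /=; apply: eq_bigr => z _.
  by rewrite -mulnDr (bigD1 y) //= addnC.
congr (_ + _)%N; case: i => [|i] /=.
  rewrite subn0 -(sum_adj y) big_distrl /=; apply: eq_bigr => z _.
  by rewrite adj_sym; case: (adj y z).
rewrite subn1 big_distrr /=.
transitivity (\sum_z \sum_w adj z y * (w != z) * nbarc x i w y)%N.
  apply: eq_bigr => z _; rewrite (adj_sym z y) mulnA mulnn.
  rewrite big_mkcond big_distrr /=; apply: eq_bigr => w _.
  by case: (adj y z); case: (w != z); rewrite ?mul1n ?mul0n.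
rewrite exchange_big; apply: eq_bigr => w _; rewrite -big_distrl /=.
rewrite nbarc_adj; case: (boolP (adj w y)) => wy; last by rewrite mul0n !muln0.
congr (_ * _)%N; rewrite -(sum_adj y) (bigD1 w) // [in RHS](bigD1 w) //=.
rewrite eqxx wy /= muln0 !add0n; apply: eq_bigr => z zw.
by rewrite eq_sym zw muln1.
Qed.

End Walks.

Section WalksDistance.

Variables (G : sgraph) (k : nat).
Hypothesis Gconn : is_connected G.
Hypothesis Gk : kregular G k.

Lemma nbw_pred (x y : G) i : (0 < nbw x i.+1 y)%N ->
  exists2 z, adj z y & (0 < nbw x i z)%N.
Proof.
case: i => [|i] pos.
  by move: pos; rewrite nbw1 lt0b => xy; exists x; rewrite //= eqxx.
have : (0 < \sum_z adj z y * nbw x i.+1 z)%N.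
  by rewrite (nbw_rec Gk) (leq_trans pos) ?leq_addr.
rewrite lt0n sum_nat_eq0 => /forallPn[z] /=.
by rewrite muln_eq0 negb_or eqb0 negbK -lt0n => /andP[]; exists z.
Qed.

Lemma nbw_dist (x y : G) i : (0 < nbw x i y)%N -> (dist x y <= i)%N.
Proof.
elim: i y => [|i IH] y; first by rewrite /= lt0b leqn0 dist_eq0.
by move=> /nbw_pred[z zy /IH dz]; apply: leq_trans (dist_adj Gconn x zy) _.
Qed.

(** Shortest walks do not backtrack.  The recurrence gives this directly, since
    its correction term counts walks shorter than the distance. *)
Lemma nbw_dist_gt0 (x y : G) : (0 < nbw x (dist x y) y)%N.
Proof.
have [n] := ubnP (dist x y); elim: n y => // n IH y; rewrite ltnS => dn.
case dE: (dist x y) => [|[|d]].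
- by move/eqP: dE; rewrite dist_eq0 //= => /eqP->; rewrite eqxx.
- have [z zy /eqP] := dist_pred Gconn dE.
  by rewrite dist_eq0 // nbw1 => /eqP <-; rewrite zy.
have [z zy dz] := dist_pred Gconn dE.
have y0 : nbw x d y = 0%N.
  apply/eqP; rewrite -leqn0 leqNgt; apply/negP => /nbw_dist.
  by rewrite dE ltnNge ltnW.
have := nbw_rec Gk x d y; rewrite y0 muln0 addn0 => <-.
rewrite (bigD1 z) // zy mul1n addn_gt0 -dz IH // dz.
by rewrite -dE.
Qed.

End WalksDistance.

(** * Adjacency algebra *)

Section Adjacency.

Variables (R : realType) (G : sgraph) (k n : nat).
Hypothesis hk : (2 <= k)%N.
Hypothesis Gk : kregular G k.
Hypothesis Gn : #|G| = n.+1.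

(** The adjacency matrix is reindexed by a type of the form 'I_n.+1, on which
    polynomials can be evaluated at matrices. *)
Definition vtx (i : 'I_n.+1) : G := enum_val (cast_ord (esym Gn) i).

Definition adjm : 'M[R]_n.+1 := castmx (Gn, Gn) (adjmx R G).

Local Notation A := adjm.

Lemma adjmE i j : A i j = (adj (vtx i) (vtx j))%:R.
Proof. by rewrite castmxE mxE. Qed.

Lemma vtx_bij : bijective vtx.
Proof.
exists (fun x => cast_ord Gn (enum_rank x)) => x; rewrite /vtx.
  by rewrite enum_valK cast_ordKV.
by rewrite cast_ordK enum_rankK.
Qed.

Lemma second_eigenvalue_adjm :
  second_eigenvalue A = second_eigenvalue (adjmx R G).
Proof. by rewrite /adjm; case: _ / Gn. Qed.

Lemma adjm_sym : A^T = A.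
Proof. by apply/matrixP => i j; rewrite mxE !adjmE adj_sym. Qed.

Lemma horner_adjm_sym (q : {poly R}) i j : horner_mx A q i j = horner_mx A q j i.
Proof.
suff /matrixP/(_ i j) : (horner_mx A q)^T = horner_mx A q by rewrite mxE.
elim/poly_ind: q {i j} => [|q a IH]; first by rewrite !rmorph0 trmx0.
rewrite rmorphD rmorphM /= horner_mx_X horner_mx_C linearD /= tr_scalar_mx.
congr (_ + _); rewrite trmx_mul IH adjm_sym.
by apply/esym/comm_horner_mx.
Qed.

Lemma adjm_rowsum i : \sum_j A i j = k%:R.
Proof.
under eq_bigr do rewrite adjmE.
rewrite -(sum_adj Gk (vtx i)) natr_sum.
have [v' vK v'K] := vtx_bij.
rewrite [RHS](reindex vtx) /=; last by exists v' => x _; [apply: vK|apply: v'K].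
by apply: eq_bigr => j _; rewrite adj_sym.
Qed.

Lemma horner_adjm_rowsum (q : {poly R}) i : \sum_j horner_mx A q i j = q.[k%:R].
Proof.
elim/poly_ind: q => [|q a IH].
  by rewrite rmorph0 horner0 big1 // => j _; rewrite mxE.
rewrite rmorphD rmorphM /= horner_mx_X horner_mx_C !hornerE -IH.
under eq_bigr do rewrite mxE [a%:M _ _]mxE.
rewrite big_split /=; congr (_ + _); last first.
  rewrite (bigD1 i) //= eqxx mulr1n big1 ?addr0 // => j.
  by rewrite eq_sym => /negPf->.
under eq_bigr do rewrite mxE.
rewrite exchange_big mulr_suml; apply: eq_bigr => j _ /=.
by rewrite -mulr_sumr adjm_rowsum.
Qed.

Lemma horner_nbpoly i a b :
  horner_mx A (nbpoly R k i) a b = (nbw (vtx a) i (vtx b))%:R.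
Proof.
have [v' vK v'K] := vtx_bij.
suff: horner_mx A (nbpoly R k i) a b = (nbw (vtx a) i (vtx b))%:R /\
  horner_mx A (nbpoly R k i.+1) a b = (nbw (vtx a) i.+1 (vtx b))%:R by case.
elim: i b => [|i IH] b.
  split; last by rewrite nbw1 horner_mx_X adjmE.
  by rewrite rmorph1 /= mxE (can_eq vK) eq_sym.
split; first by case: (IH b).
have [IHb _] := IH b.
have -> : horner_mx A (nbpoly R k i.+2) = horner_mx A (nbpoly R k i.+1) *m A -
    branching R k i *: horner_mx A (nbpoly R k i).
  rewrite nbpolyS mulrC rmorphB !rmorphM /= horner_mx_X horner_mx_C.
  by congr (_ - _); apply: mul_scalar_mx.
rewrite !mxE IHb.
have -> : \sum_j horner_mx A (nbpoly R k i.+1) a j * A j b =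
  (\sum_z adj z (vtx b) * nbw (vtx a) i.+1 z)%:R.
  rewrite natr_sum [RHS](reindex vtx) /=; last first.
    by exists v' => x _; [apply: vK|apply: v'K].
  by apply: eq_bigr => j _; rewrite (IH j).2 adjmE mulrC natrM.
rewrite (nbw_rec Gk) natrD natrM.
rewrite /branching; case: eqP => _ /=; rewrite ?subn0 ?addrK //.
by rewrite natrB ?addrK // ltnW.
Qed.

Definition nbwball (x : G) m (y : G) : nat := \sum_(i < m.+1) nbw x i y.

Lemma horner_nbball m a b :
  horner_mx A (nbball R k m) a b = (nbwball (vtx a) m (vtx b))%:R.
Proof.
rewrite /nbball rmorph_sum summxE natr_sum.
by apply: eq_bigr => i _; apply: horner_nbpoly.
Qed.

Lemma root_char_adjm : root (char_poly A) k%:R.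
Proof.
rewrite -eigenvalue_root_char; apply/eigenvalueP; exists (const_mx 1).
  apply/rowP => j; rewrite !mxE mulr1 -(adjm_rowsum j).
  by apply: eq_bigr => i _; rewrite mxE mul1r -[in RHS]adjm_sym mxE.
by apply/rowV0Pn; exists (const_mx 1); rewrite ?submx_refl //; apply/eqP => /rowP/(_ 0);
  rewrite !mxE => /eqP; rewrite oner_eq0.
Qed.



(** * The trace inequality *)

Variables (m : nat) (c lam : R).
Hypothesis hc : 0 < c.
Hypothesis lam_root : root (Tpoly k m c) lam.
Hypothesis lam_lt : lam < k%:R.
Hypothesis lam_pos : forall i, (i <= m)%N -> 0 < (nbball R k i).[lam].
Hypothesis Glam : second_eigenvalue (adjmx R G) <= lam.

Local Notation S := (nbkernel k m lam).
Local Notation P := (Tpoly k m c).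
Local Notation g := (nbball R k m).[lam].

(** In the Christoffel-Darboux formula at lam, P(lam) = 0 lets G_(m+1)(lam) be
    replaced by - (c-1) G_m(lam). *)
Lemma nbkernel_Tpoly : ('X - lam%:P) * S = g *: P.
Proof.
rewrite christoffel_darboux /Tpoly.
have : (nbball R k m.+1).[lam] = - ((c - 1) * g).
  by move/rootP: lam_root; rewrite Tpoly_horner => /eqP; rewrite addr_eq0 => /eqP.
move=> ->; rewrite nbballS scaleNr opprK !scalerDr scalerA -!mul_polyC.
by rewrite !(polyCM, polyCB) polyC1; ring.
Qed.

(** As lam < k bounds the second entry of the sorted spectrum and k is an
    eigenvalue, k has to be the first entry. *)
Lemma adjm_spectrum : exists2 r : seq R, forall z, z \in r -> z <= lam &
  forall q : {poly R}, \tr (horner_mx A q) = q.[k%:R] + \sum_(z <- r) q.[z].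
Proof.
have [s As trA] := symmetric_trace adjm_sym.
have ps := perm_spectrum As.
have ks : k%:R \in spectrum A.
  by rewrite (perm_mem ps) -root_prod_XsubC -As root_char_adjm.
have := Glam; rewrite -second_eigenvalue_adjm /second_eigenvalue.
have := spectrum_sorted A; move: ps ks; case: (spectrum A) => // x r ps xr sr rlam.
have rle z : z \in r -> z <= lam.
  case: r sr rlam {ps xr} => //= y r /andP[_ yr] ylam.
  rewrite inE => /predU1P[->//|zr]; apply: le_trans ylam.
  have /allP/(_ z zr) // : all (fun w => w <= y) r.
  by apply: order_path_min yr => a b d /= ba ad; apply: le_trans ad ba.
have kx : k%:R = x.
  move: xr; rewrite inE => /predU1P[//|/rle]; by rewrite leNgt lam_lt.
exists r => // q.
have -> : q.[k%:R] + \sum_(z <- r) q.[z] = \sum_(z <- k%:R :: r) q.[z].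
  by rewrite big_cons.
by rewrite trA kx; apply: perm_big; rewrite perm_sym.
Qed.


Lemma kernel_weight_gt0 (i : nat) : (i <= m)%N ->
  0 < (k%:R - 1) ^+ (m - i) * (nbball R k i).[lam].
Proof.
by move=> im; rewrite mulr_gt0 ?lam_pos // exprn_gt0 // subr_gt0 ltr1n.
Qed.

Lemma nbkernel_valency_gt0 : 0 < S.[k%:R].
Proof.
rewrite /nbkernel horner_sum big_ord_recr /= ltr_wpDl //.
  apply: sumr_ge0 => i _; rewrite hornerZ ltW // mulr_gt0 ?nbball_gt0 //.
  by rewrite kernel_weight_gt0 // ltnW.
by rewrite hornerZ mulr_gt0 ?nbball_gt0 ?kernel_weight_gt0.
Qed.

Lemma horner_Tpoly a b : horner_mx A P a b =
  (nbw (vtx a) m.+1 (vtx b))%:R + c * (nbwball (vtx a) m (vtx b))%:R.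
Proof.
rewrite -horner_nbpoly -horner_nbball /Tpoly.
by set q := nbpoly R k m.+1; rewrite rmorphD /= horner_mxZ mxE [X in _ + X]mxE.
Qed.

(** Either no walk of length at most m joins the two vertices, and S(A) vanishes
    there, or at least one does, and the summand c G_m of P contributes at
    least c; this is where integrality of walk counts enters. *)
Lemma Tpoly_kernel_entry a b :
  c * horner_mx A S a b <= horner_mx A P a b * horner_mx A S a b.
Proof.
have SE : horner_mx A S a b = \sum_(i < m.+1)
    (k%:R - 1) ^+ (m - i) * (nbball R k i).[lam] * (nbwball (vtx a) i (vtx b))%:R.
  rewrite /nbkernel rmorph_sum summxE /=; apply: eq_bigr => i _.
  by rewrite horner_mxZ mxE horner_nbball.
have [B0|Bpos] := posnP (nbwball (vtx a) m (vtx b)).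
  have -> : horner_mx A S a b = 0.
    rewrite SE big1 // => i _.
    have -> : nbwball (vtx a) i (vtx b) = 0%N; last by rewrite mulr0.
    apply/eqP; rewrite sum_nat_eq0; apply/forallP => j /=.
    have jm : (j < m.+1)%N by apply: leq_trans (ltn_ord j) _; rewrite ltnS -ltnS.
    move/eqP: B0; rewrite sum_nat_eq0 => /forallP/(_ (Ordinal jm)); exact.
  by rewrite !mulr0.
apply: ler_wpM2r.
  rewrite SE sumr_ge0 // => i _; rewrite mulr_ge0 ?ler0n // ltW //.
  by rewrite kernel_weight_gt0 // -ltnS.
rewrite horner_Tpoly -[c in c <= _]mulr1 ler_wpDl ?ler0n //.
by rewrite ler_pM2l // ler1n.
Qed.

Lemma trace_kernel_bound :
  c * n.+1%:R * S.[k%:R] <= \tr (horner_mx A (P * S)).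
Proof.
have -> : c * n.+1%:R * S.[k%:R] = \sum_(a < n.+1) \sum_b c * horner_mx A S a b.
  under eq_bigr do rewrite -mulr_sumr horner_adjm_rowsum.
  by rewrite sumr_const card_ord -mulr_natr; ring.
rewrite rmorphM /= /mxtrace; apply: ler_sum => a _; rewrite mxE.
apply: ler_sum => b _; rewrite [horner_mx A S b a]horner_adjm_sym.
exact: Tpoly_kernel_entry.
Qed.

(** Equality forces each nonpositive spectral contribution to vanish, whence
    P(z) = 0 on the remaining eigenvalues.  Then P(A) and c J have the same row
    sums and the same sum of squared entries P(k)^2, so the squared entries of
    P(A) - c J sum to zero. *)
Lemma order_trace_bound : c * n.+1%:R <= P.[k%:R] /\
  (c * n.+1%:R = P.[k%:R] -> forall a b, horner_mx A P a b = c).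
Proof.
have [r rle trA] := adjm_spectrum.
have g0 : 0 < g by apply: lam_pos.
have S0 := nbkernel_valency_gt0.
have SP z : (z - lam) * S.[z] = g * P.[z].
  by rewrite -hornerZ -nbkernel_Tpoly hornerM hornerXsubC.
have fE z : g * (P * S).[z] = (z - lam) * S.[z] ^+ 2.
  by rewrite hornerM mulrA -SP; ring.
have fr z : z \in r -> g * (P * S).[z] <= 0.
  by move=> zr; rewrite fE mulr_le0_ge0 ?sqr_ge0 // subr_le0 rle.
have sumr0 : \sum_(z <- r) (P * S).[z] <= 0.
  by rewrite big_seq sumr_le0 // => z zr; rewrite -(pmulr_rle0 _ g0) fr.
have bound := trace_kernel_bound; rewrite trA hornerM in bound.
split.
  by rewrite -(ler_pM2r S0); apply: le_trans bound _; rewrite gerDl.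
move=> eqn; rewrite eqn lerDl in bound.
have Pr z : z \in r -> P.[z] = 0.
  have : \sum_(z <- r | z \in r) - (P * S).[z] == 0.
    by rewrite -big_seq sumrN oppr_eq0 eq_le sumr0.
  rewrite psumr_eq0 => [/allP/(_ z) h zr|y yr]; last first.
    by rewrite oppr_ge0 -(pmulr_rle0 _ g0) fr.
  have := h zr; rewrite zr oppr_eq0 /= => /eqP PSz.
  move: (fE z); rewrite PSz mulr0 expr2 mulrA => /esym/eqP.
  rewrite mulf_eq0 => SP0; have : g * P.[z] == 0.
    by rewrite -SP; case/orP: SP0 => // /eqP->; rewrite mulr0.
  by rewrite mulf_eq0 gt_eqF // => /eqP.
have sq0 : \sum_(a < n.+1) \sum_b (horner_mx A P a b - c) ^+ 2 = 0.
  have trPP : \sum_(a < n.+1) \sum_b horner_mx A P a b ^+ 2 = P.[k%:R] ^+ 2.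
    have := trA (P * P); rewrite hornerM big_seq big1 ?addr0 => [|z /Pr Pz]; last first.
      by rewrite hornerM Pz mulr0.
    move=> trP; rewrite [RHS]expr2 -trP rmorphM /= /mxtrace; apply: eq_bigr => a _.
    rewrite mxE; apply: eq_bigr => b _.
    by rewrite [horner_mx A P b a]horner_adjm_sym expr2.
  under eq_bigr do under eq_bigr do rewrite sqrrB.
  under eq_bigr do rewrite big_split sumrB /= sumr_const card_ord.
  rewrite big_split sumrB /= trPP sumr_const card_ord.
  have -> : \sum_(a < n.+1) \sum_b horner_mx A P a b * c *+ 2 =
      n.+1%:R * (P.[k%:R] * c *+ 2).
    under eq_bigr do rewrite sumrMnl -mulr_suml horner_adjm_rowsum.
    by rewrite sumr_const card_ord mulr_natl.
  rewrite -[_ *+ n.+1 *+ n.+1]mulr_natr -[c ^+ 2 *+ n.+1]mulr_natr -eqn.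
  by move: (n.+1%:R : R) => N; ring.
move=> a b; apply/eqP; rewrite -subr_eq0 -sqrf_eq0.
have rowge0 a' : 0 <= \sum_b (horner_mx A P a' b - c) ^+ 2.
  by apply: sumr_ge0 => b' _; apply: sqr_ge0.
have row0 : \sum_b (horner_mx A P a b - c) ^+ 2 = 0.
  by apply: (psumr_eq0P _ sq0).
by apply/eqP; apply: (psumr_eq0P _ row0) => // b' _; apply: sqr_ge0.
Qed.

End Adjacency.

Lemma nbw_exists (R : realType) (G : sgraph) (k : nat) (x : G) i :
  (2 <= k)%N -> kregular G k -> exists y, (0 < nbw x i y)%N.
Proof.
move=> hk Gk; have Gpos : (0 < #|G|)%N by apply/card_gt0P; exists x.
have Gn : #|G| = #|G|.-1.+1 by rewrite prednK.
have [v' _ v'K] := vtx_bij Gn.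
have := nbpoly_gt0 hk i (lexx (k%:R : R)).
rewrite -(horner_adjm_rowsum Gk Gn _ (v' x)).
under eq_bigr do rewrite (horner_nbpoly _ hk Gk) v'K.
rewrite -natr_sum ltr0n lt0n sum_nat_eq0 => /forallPn[b] /=.
by rewrite -lt0n; exists (vtx Gn b).
Qed.

(** * Graphs attaining the bound *)

Section Equality.

Variables (R : realType) (G : sgraph) (k m : nat) (c : R).
Hypothesis hk : (2 <= k)%N.
Hypothesis hc : 0 < c.
Hypothesis Gconn : is_connected G.
Hypothesis Gk : kregular G k.
Hypothesis tight : forall x y : G,
  (nbw x m.+1 y)%:R + c * (nbwball x m y)%:R = c.

Lemma nbw_le_ball (x y : G) i : (i <= m)%N -> (nbw x i y <= nbwball x m y)%N.
Proof. by move=> im; rewrite /nbwball (bigD1 (Ordinal (im : i < m.+1)%N)) //= leq_addr. Qed.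

Lemma nbwball_le1 (x y : G) : (nbwball x m y <= 1)%N.
Proof.
rewrite -(ler_nat R) -(ler_pM2l hc) mulr1 -[leRHS](tight x y).
by rewrite lerDr ler0n.
Qed.

Lemma nbwball_dist (x y : G) : nbwball x m y = (dist x y <= m)%N.
Proof.
have := nbwball_le1 x y; have [dm|md] := leqP (dist x y) m.
  move=> B1; apply/eqP; rewrite eqn_leq B1.
  by rewrite (leq_trans (nbw_dist_gt0 Gconn Gk x y)) // nbw_le_ball.
move=> _; apply/eqP; rewrite sum_nat_eq0; apply/forallP => i /=.
rewrite -leqn0 leqNgt; apply/negP => /(nbw_dist Gconn Gk) di.
by move: (leq_trans md di); rewrite ltnNge -ltnS ltn_ord.
Qed.

Lemma dist_lt (x y : G) : (dist x y < m.+2)%N.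
Proof.
have [/leqW|md] := leqP (dist x y) m; first by rewrite ltnS.
have := tight x y; rewrite nbwball_dist leqNgt md mulr0 addr0 => nc.
by rewrite ltnS (nbw_dist Gconn Gk) // -(ltr0n R) nc.
Qed.

(** F_i(A) is the distance-i matrix, up to the factor c in the last case. *)
Lemma nbw_sphere (x y : G) i : (i <= m.+1)%N ->
  (nbw x i y)%:R = (if i == m.+1 then c else 1) * (dist x y == i)%:R :> R.
Proof.
rewrite leq_eqVlt => /predU1P[->|]; last rewrite ltnS => im.
  rewrite eqxx; have := tight x y; rewrite nbwball_dist => /(canRL (addrK _))->.
  have [dm|md] := leqP (dist x y) m; last first.
    by rewrite mulr0 subr0 eqn_leq md -ltnS dist_lt mulr1.
  by rewrite mulr1 subrr ltn_eqF ?mulr0 // ltnS.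
rewrite ltn_eqF // mul1r; congr _%:R.
have [di|dNi] := eqVneq (dist x y) i.
  apply/eqP; rewrite eqn_leq (leq_trans _ (nbwball_le1 x y)) ?nbw_le_ball //=.
  by rewrite -di (nbw_dist_gt0 Gconn Gk).
apply/eqP; rewrite -leqn0 leqNgt; apply/negP => ni.
have di := nbw_dist Gconn Gk ni.
have dm : (dist x y < m.+1)%N by rewrite ltnS (leq_trans di).
have := nbwball_le1 x y; rewrite /nbwball.
rewrite (bigD1 (Ordinal (im : i < m.+1)%N)) //= (bigD1 (Ordinal dm)) //=.
have := nbw_dist_gt0 Gconn Gk x y.
by case: (nbw x (dist x y) y) (nbw x i y) ni => // a [//|b] _ _; rewrite addnS.
Qed.

Lemma card_sphere_adj (x y : G) j :
  #|[set z | adj y z & dist x z == j]| = (\sum_z adj z y * (dist x z == j))%N.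
Proof.
rewrite -sum1_card [LHS]big_mkcond; apply: eq_bigr => z _.
by rewrite inE adj_sym; case: (adj z y); case: (dist x z == j).
Qed.

(** Summing [nbw_sphere] over neighbours turns the recurrence of the walk counts
    into the column [j] of the tridiagonal matrix. *)
Lemma sphere_quotient (x y : G) j : (j <= m)%N ->
  #|[set z | adj y z & dist x z == j]|%:R = Toff k m.+2 c (dist x y) j :> R.
Proof.
move=> jm; rewrite card_sphere_adj.
have -> : (\sum_z adj z y * (dist x z == j) = \sum_z adj z y * nbw x j z)%N.
  apply: eq_bigr => z _; congr (_ * _)%N; apply/eqP; rewrite eq_sym -(eqr_nat R).
  by rewrite nbw_sphere ?leqW // ltn_eqF // mul1r.
have low : (nbw x j.+1 y)%:R = Toff k m.+2 c j.+1 j * (dist x y == j.+1)%:R.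
  by rewrite nbw_sphere // Toff_lower eqSS.
have far : dist x y != j.+1 -> j != (dist x y).+1 -> Toff k m.+2 c (dist x y) j = 0.
  exact: Toff_far.
case: j jm low far => [|j] jm low far.
  have -> : (\sum_z adj z y * nbw x 0 z = nbw x 1 y)%N.
    rewrite nbw1 (bigD1 x) //= eqxx muln1 big1 ?addn0 // => z /negPf->.
    by rewrite muln0.
  by rewrite low; have [->|/far->] := eqVneq (dist x y) 1%N; rewrite ?mulr1 ?mulr0.
rewrite (nbw_rec Gk) natrD natrM low (@nbw_sphere x y j); last by rewrite ltnW // ltnW.
rewrite [j == m.+1]ltn_eqF ?mul1r; last by rewrite ltnW.
have -> : (k - (j != 0))%:R = branching R k j.
  by rewrite /branching; case: eqP => _; rewrite ?subn0 // natrB // ltnW.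
have [->|dN] := eqVneq (dist x y) j.+2.
  by rewrite mulr1 [_ == j]gtn_eqF ?mulr0 ?addr0 // ltnW.
rewrite mulr0 add0r; have [->|dNj] := eqVneq (dist x y) j.
  by rewrite mulr1 Toff_upper.
by rewrite mulr0 far // eqSS eq_sym.
Qed.

Lemma equality_quotient : distance_quotient G (Tmx k m.+2 c).
Proof.
move=> x; split; first exact: dist_lt.
  move=> i; have [y ypos] := nbw_exists R x m.+1 hk Gk.
  have dy : dist x y = m.+1.
    apply/eqP; have := @nbw_sphere x y m.+1 (leqnn _); rewrite eqxx.
    by case: eqP => // _ /eqP; rewrite mulr0 pnatr_eq0 -leqn0 leqNgt ypos.
  by apply: (dist_between Gconn (y := y)); rewrite dy -ltnS.
move=> i j y dy; have [jm|] := leqP j m.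
  by rewrite sphere_quotient // dy Tmx_off.
(* The last column is forced by the row sums, k on both sides. *)
move=> mj; have jE : j = ord_max.
  by apply/val_inj/eqP; rewrite eqn_leq mj -ltnS ltn_ord.
have : \sum_(l < m.+2) #|[set z | adj y z & dist x z == l]|%:R =
       \sum_l Tmx k m.+2 c i l.
  rewrite Tmx_rowsum -natr_sum; congr _%:R.
  under eq_bigr do rewrite card_sphere_adj.
  rewrite exchange_big -(sum_adj Gk y); apply: eq_bigr => z _ /=.
  rewrite -big_distrr /= (bigD1 (Ordinal (dist_lt x z))) //= eqxx.
  rewrite big1 ?addn0 ?muln1 // => l; rewrite -val_eqE /= eq_sym.
  by move/negPf->.
rewrite jE => E; rewrite big_ord_recr [RHS]big_ord_recr /= in E.
have same (l : 'I_m.+1) : #|[set z | adj y z & dist x z == l]|%:R =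
    Tmx k m.+2 c i (widen_ord (leqnSn _) l).
  have lm : (l <= m)%N by rewrite -ltnS.
  by rewrite sphere_quotient // dy Tmx_off.
by move: E; rewrite (eq_bigr _ (fun l _ => same l)) => /addrI.
Qed.

End Equality.

(** * Graphs with quotient matrix T(k,t,c) *)

Lemma quotient_distance_regular (R : realType) (G : sgraph) (m : nat)
    (Q : 'M[R]_m.+2) :
  is_connected G -> distance_quotient G Q -> distance_regular G.
Proof.
move=> Gconn GQ; split=> //.
(* Entries of Q at distances that occur are natural numbers, so truncation
   recovers them; no sphere has radius m.+2 or more. *)
exists (fun i => if (i.+1 < m.+2)%N then Num.truncn (Q (inord i) (inord i.+1)) else 0%N).
exists (fun i => if i is j.+1 then Num.truncn (Q (inord i) (inord j)) else 0%N).
move=> x y; have [lt _ Qc] := GQ x.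
have [dlt dE] : (dist x y < m.+2)%N /\ dist x y = @inord m.+1 (dist x y).
  by rewrite inordK.
split.
  case: ifP => dS; last first.
    apply/eqP; rewrite cards_eq0; apply/eqP/setP => z; rewrite !inE.
    by apply/negP => /andP[_ /eqP zE]; have := lt z; rewrite zE dS.
  by rewrite -(Qc _ _ _ dE) natrK inordK.
case dy: (dist x y) => [|j].
  apply/eqP; rewrite cards_eq0; apply/eqP/setP => z; rewrite !inE.
  by rewrite andbF.
rewrite -dy -(Qc _ _ _ dE) natrK inordK; last by rewrite dy in dlt; apply: ltnW.
by rewrite dy.
Qed.

Section Order.

Variables (R : realType) (G : sgraph) (k m : nat) (c : R).
Hypothesis Gconn : is_connected G.
Hypothesis GT : distance_quotient G (Tmx k m.+2 c).

(** Both sides count the edges between two spheres around [x]. *)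
Lemma sphere_edges (x : G) (i j : 'I_m.+2) :
  #|[set y | dist x y == i]|%:R * Tmx k m.+2 c i j =
  #|[set y | dist x y == j]|%:R * Tmx k m.+2 c j i.
Proof.
have [_ _ Tc] := GT x.
have cnt (a b : 'I_m.+2) : #|[set y | dist x y == a]|%:R * Tmx k m.+2 c a b =
    (\sum_y \sum_z (dist x y == a) && (dist x z == b) && adj y z)%:R.
  rewrite -sum1_card natr_sum mulr_suml natr_sum big_mkcond /=.
  apply: eq_bigr => y _; rewrite inE; case: eqP => [dy|_] /=; last by rewrite big1.
  rewrite mul1r -(Tc _ _ _ dy) -sum1_card big_mkcond; congr _%:R.
  apply: eq_bigr => z _; rewrite inE /= andbC.
  by case: (_ && _).
rewrite !cnt exchange_big; congr _%:R; apply: eq_bigr => y _; apply: eq_bigr => z _.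
by rewrite adj_sym [X in X && _]andbC.
Qed.

Lemma sphere_size (x : G) j : (j <= m)%N ->
  #|[set y | dist x y == j]|%:R = (nbpoly R k j).[k%:R] /\
  c * #|[set y | dist x y == m.+1]|%:R = (nbpoly R k m.+1).[k%:R].
Proof.
have bF i : (nbpoly R k i.+1).[k%:R] = (nbpoly R k i).[k%:R] * branching R k i.
  case: i => [|i]; first by rewrite /branching /= !hornerE.
  by rewrite !nbpoly_valency exprS /branching /=; ring.
have step i : (i <= m)%N -> #|[set y | dist x y == i]|%:R * branching R k i =
    #|[set y | dist x y == i.+1]|%:R * (if i == m then c else 1).
  move=> im; have i2 : (i < m.+2)%N by rewrite ltnS ltnW.
  have iS : (i.+1 < m.+2)%N by rewrite !ltnS.
  have := sphere_edges x (Ordinal i2) (Ordinal iS).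
  by rewrite [X in _ = _ * X]Tmx_off //= Toff_lower mxE -val_eqE /= ltn_eqF // Toff_upper.
have sizeF i : (i <= m)%N -> #|[set y | dist x y == i]|%:R = (nbpoly R k i).[k%:R].
  elim: i => [_|i IH im].
    rewrite hornerE (_ : [set _ | _] = [set x]) ?cards1 //.
    by apply/setP => y; rewrite !inE dist_eq0.
  by rewrite bF -IH 1?ltnW // step ?ltn_eqF ?mulr1 // ltnW.
by move=> jm; split; [apply: sizeF | rewrite bF -sizeF // step // eqxx mulrC].
Qed.

Lemma quotient_order : c * #|G|%:R = (Tpoly k m c).[k%:R].
Proof.
have [/card_gt0P[x _] _] := Gconn; have [lt _ _] := GT x.
have -> : #|G| = (\sum_(j < m.+2) #|[set y | dist x y == j]|)%N.
  under eq_bigr do rewrite -sum1_card big_mkcond.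
  rewrite exchange_big -sum1_card; apply: eq_bigr => y _ /=.
  rewrite (bigD1 (Ordinal (lt y))) //= inE eqxx big1 // => j.
  by rewrite inE -val_eqE /= eq_sym => /negPf->.
rewrite natr_sum big_ord_recr mulrDr /= (sphere_size x (leqnn m)).2.
rewrite /Tpoly /nbball hornerD hornerZ horner_sum addrC; congr (_ + c * _).
by apply: eq_bigr => j _; rewrite (sphere_size x _).1 // -ltnS.
Qed.

End Order.

Lemma MboundE (R : realType) (k m : nat) (c : R) : 0 < c ->
  c * Mbound k m.+2 c = (Tpoly k m c).[k%:R].
Proof.
move=> hc; rewrite /Mbound !subSS subn0 /Tpoly hornerD hornerZ nbpoly_valency.
rewrite mulrDr [c * (_ / c)]mulrC divfK ?gt_eqF // addrC; congr (_ + c * _).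
rewrite big_mkord /nbball horner_sum big_ord_recl hornerE; congr (_ + _).
by apply: eq_bigr => i _; rewrite nbpoly_valency.
Qed.

Lemma order_admissible (R : realType) (G : sgraph) (k m : nat) (c : R) :
  (2 <= k)%N -> 0 < c ->
  admissible k (second_eigenvalue (Tmx k m.+2 c)) G ->
  c * #|G|%:R <= (Tpoly k m c).[k%:R] /\
  (c * #|G|%:R = (Tpoly k m c).[k%:R] ->
    forall x y : G, (nbw x m.+1 y)%:R + c * (nbwball x m y)%:R = c).
Proof.
move=> hk hc [[Gpos _] Gk Glam].
have Gn : #|G| = #|G|.-1.+1 by rewrite prednK.
have [rlam lamk lampos] := second_eigenvalue_Tmx m hk hc.
have [le eq] := order_trace_bound hk Gk Gn hc rlam lamk lampos Glam.
rewrite Gn; split=> // /eq PE x y.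
have [v' _ v'K] := vtx_bij Gn.
by rewrite -[x]v'K -[y]v'K -(horner_Tpoly hk Gk) PE.
Qed.

Theorem theorem2p3 (R : realType) (k t : nat) (c : R)
    (hk : (2 <= k)%N) (ht : (2 <= t)%N) (hc : 0 < c) :
  let lambda2 := second_eigenvalue (Tmx k t c) in
  (vmax k lambda2 <= (Mbound k t c)%:E)%E /\
  forall G : sgraph,
    is_connected G -> kregular G k ->
    second_eigenvalue (adjmx R G) <= lambda2 ->
    (#|G|%:R)%:E = vmax k lambda2 ->
    (vmax k lambda2 = (Mbound k t c)%:E <->
     distance_regular G /\ distance_quotient G (Tmx k t c)).
Proof.
case: t ht => [|[|m]] // _ lambda2; have ME := MboundE k m hc.
split.
  apply: ge_ereal_sup => x [->|[G adG ->]]; rewrite lee_fin -(ler_pM2l hc) ME.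
    by rewrite mulr0 ltW // Tpoly_gt0.
  by have [] := order_admissible hk hc adG.
move=> G Gconn Gk Glam <-; split=> [[nM]|[_ GT]].
  have [_ /(_ _)attained] := order_admissible hk hc (And3 Gconn Gk Glam).
  have GT : distance_quotient G (Tmx k m.+2 c).
    by apply: equality_quotient => //; apply: attained; rewrite nM.
  by split=> //; apply: quotient_distance_regular GT.
congr _%:E; apply: (mulfI (lt0r_neq0 hc)).
by rewrite ME; apply: quotient_order.
Qed.
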